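(* Let $\tau$ be a structure with a space-rooted metrization $\tau^{\mathrm{srm}}$. If $\tau$ is embedding-continuous, then $d_{\mathfrak{M}_\bullet}^{\tau^{\mathrm{srm}}}$ is a metric on $\mathfrak{M}_\bullet(\tau)$.
   Context: A bcm (boundedly-compact metric) space is a non-empty metric space in which every closed ball of finite radius is compact; a rooted bcm space $(X,\rho_X)$ is a bcm space $X$ with a distinguished point $\rho_X$. The metric of $X$ is denoted $d_X$, and $D_X(x,r)=\{y: d_X(x,y)\le r\}$. An isometric embedding is a distance-preserving map (not necessarily onto); an isometry is a bijective one; a map is root-preserving if it sends root to root. A topological embedding is a homeomorphism onto its image. Structure: a functor $\tau$ from the category of bcm spaces (morphisms: isometric embeddings) to the category of metrizable topological spaces (morphisms: topological embeddings). That is, to each bcm space $X$ it assigns a metrizable space $\tau(X)$ and to each isometric embedding $f\colon X\to Y$ a topological embedding $\tau_f\colon\tau(X)\to\tau(Y)$, with $\tau_{\mathrm{id}_X}=\mathrm{id}_{\tau(X)}$ and $\tau_{g\circ f}=\tau_g\circ\tau_f$. $\tau$ is embedding-continuous if, whenever $X,Y$ are bcm spaces and $f_n\colon X\to Y$, $n\in\mathbb{N}\cup\{\infty\}$, are isometric embeddings with $f_n\to f_\infty$ uniformly on compact sets, one has $\tau_{f_n}(a)\to\tau_{f_\infty}(a)$ in $\tau(Y)$ for all $a\in\tau(X)$. $\mathfrak{M}_\bullet(\tau)$: the set of (representatives of) equivalence classes of triples $(X,\rho_X,a_X)$, with $(X,\rho_X)$ a rooted bcm space and $a_X\in\tau(X)$,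 where $(X,\rho_X,a_X)\sim(Y,\rho_Y,a_Y)$ iff there is a root-preserving isometry $f\colon X\to Y$ with $\tau_f(a_X)=a_Y$. Space-rooted metrization $\tau^{\mathrm{srm}}$ of $\tau$: a choice, for each rooted bcm space $(X,\rho_X)$, of a metric $d^{\tau^{\mathrm{srm}}}_{X,\rho_X}$ on $\tau(X)$ inducing the given topology of $\tau(X)$, such that for every root-preserving isometric embedding $f\colon(X,\rho_X)\to(Y,\rho_Y)$ the map $\tau_f$ is distance-preserving. Hausdorff metric on compact subsets (including $\emptyset$) of a metric space $M$: $d^H_M(A,B)=\inf\{\varepsilon\ge0: A\subseteq B^\varepsilon, B\subseteq A^\varepsilon\}$, where $A^\varepsilon=\{x:\exists y\in A, d_M(x,y)\le\varepsilon\}$ and $\inf\emptyset=\infty$. For a rooted bcm space $(M,\rho)$ and closed $A,B\subseteq M$, $$d^F_{M,\rho}(A,B)=\int_0^\infty e^{-r}\bigl(1\wedge d^H_M(A\cap D_M(\rho,r),B\cap D_M(\rho,r))\bigr)dr.$$ For $\mathcal{X}=(X,\rho_X,a_X)$, $\mathcal{Y}=(Y,\rho_Y,a_Y)$ in $\mathfrak{M}_\bullet(\tau)$, $$d_{\mathfrak{M}_\bullet}^{\tau^{\mathrm{srm}}}(\mathcal{X},\mathcal{Y})=\inf_{f,g,Z}\bigl\{d^F_{Z,\rho_Z}(f(X),g(Y))\vee d^{\tau^{\mathrm{srm}}}_{Z,\rho_Z}(\tau_f(a_X),\tau_g(a_Y))\bigr\},$$ the infimum being over all rooted bcm spaces $(Z,\rho_Z)$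 and root-preserving isometric embeddings $f\colon X\to Z$, $g\colon Y\to Z$. *)

(* Defs.v *)
From HB Require Import structures.
From mathcomp Require Import all_boot all_order all_algebra.
From mathcomp Require Import all_classical all_reals all_analysis.

Set Implicit Arguments.
Unset Strict Implicit.
Unset Printing Implicit Defensive.

Import Order.TTheory GRing.Theory Num.Theory.
Import numFieldNormedType.Exports.

Local Open Scope classical_set_scope.
Local Open Scope ring_scope.

Definition is_metric (R : realType) (T : Type) (d : T -> T -> R) : Prop :=
  [/\ forall x y, 0 <= d x y,
      forall x y, d x y = 0 <-> x = y,
      forall x y, d x y = d y x &
      forall x y z, d x z <= d x y + d y z].

Definition induces_topology (R : realType) (T : topologicalType)
    (d : T -> T -> R) : Prop :=
  forall (a : T) (A : set T),
    nbhs a A <-> exists2 e : R, 0 < e & [set b | d a b < e] `<=` A.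

Definition metrizable (R : realType) (T : topologicalType) : Prop :=
  exists d : T -> T -> R, is_metric d /\ induces_topology d.

Definition topological_embedding (S T : topologicalType) (f : S -> T) : Prop :=
  [/\ injective f, continuous f &
      forall U : set S, open U ->
        exists2 V : set T, open V & f @` U = V `&` range f].

(* The library's [closed_ball] is the closure of the open ball, which can be
   strictly smaller than this set. *)
Definition cball (R : realType) (M : metricType R) (x : M) (r : R) : set M :=
  [set y | mdist x y <= r].

Record bcm (R : realType) := Bcm {
  bcm_space :> metricType R;
  bcm_nonempty : inhabited bcm_space;
  bcm_compact : forall (x : bcm_space) (r : R), compact (cball x r) }.

Record rooted_bcm (R : realType) := RootedBcm {
  rooted_space :> bcm R;
  root : rooted_space }.

Record isometric_embedding (R : realType) (X Y : bcm R) := IsometricEmbedding {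
  embedding_fun :> X -> Y;
  embedding_mdist : forall x y,
    mdist (embedding_fun x) (embedding_fun y) = mdist x y }.

Definition embedding_id (R : realType) (X : bcm R) : isometric_embedding X X :=
  @IsometricEmbedding R X X id (fun x y => erefl).

Definition embedding_comp (R : realType) (X Y Z : bcm R)
    (g : isometric_embedding Y Z) (f : isometric_embedding X Y) :
    isometric_embedding X Z :=
  @IsometricEmbedding R X Z (g \o f) (fun x y =>
    etrans (embedding_mdist g (f x) (f y)) (embedding_mdist f x y)).

Definition root_preserving (R : realType) (X Y : rooted_bcm R)
    (f : isometric_embedding X Y) : Prop :=
  f (root X) = root Y.

Record bcm_structure (R : realType) := BcmStructure {
  tau_obj :> bcm R -> topologicalType;
  tau_metrizable : forall X, metrizable R (tau_obj X);
  tau_map : forall X Y : bcm R,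
    isometric_embedding X Y -> tau_obj X -> tau_obj Y;
  tau_embedding : forall (X Y : bcm R) (f : isometric_embedding X Y),
    topological_embedding (tau_map f);
  tau_id : forall X : bcm R, tau_map (embedding_id X) = id;
  tau_comp : forall (X Y Z : bcm R) (g : isometric_embedding Y Z)
      (f : isometric_embedding X Y),
    tau_map (embedding_comp g f) = tau_map g \o tau_map f }.

Definition embedding_continuous (R : realType) (tau : bcm_structure R) : Prop :=
  forall (X Y : bcm R) (f : nat -> isometric_embedding X Y)
      (foo : isometric_embedding X Y),
    {family compact, (fun n => f n : X -> Y) @ \oo --> (foo : X -> Y)} ->
    forall a : tau X, (fun n => tau_map (f n) a) @ \oo --> tau_map foo a.

Record space_rooted_metrization (R : realType) (tau : bcm_structure R) :=
  SpaceRootedMetrization {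
    srm_dist :> forall X : rooted_bcm R, tau X -> tau X -> R;
    srm_metric : forall X, is_metric (@srm_dist X);
    srm_topology : forall X, induces_topology (@srm_dist X);
    srm_isometric : forall (X Y : rooted_bcm R) (f : isometric_embedding X Y),
      root_preserving f -> forall a b : tau X,
      srm_dist (X := Y) (tau_map f a) (tau_map f b) = srm_dist (X := X) a b }.

Definition thickening (R : realType) (M : metricType R) (A : set M) (e : R) :
    set M :=
  [set x | exists2 y, A y & mdist x y <= e].

Definition hausdorff_dist (R : realType) (M : metricType R) (A B : set M) :
    \bar R :=
  ereal_inf [set e%:E | e in
    [set e : R | [/\ 0 <= e, A `<=` thickening B e & B `<=` thickening A e]]].

Definition fell_dist (R : realType) (M : rooted_bcm R) (A B : set M) : \bar R :=
  (\int[lebesgue_measure]_(r in `[0%R, +oo[)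
    ((expR (- r))%:E *
     mine 1 (hausdorff_dist (A `&` cball (root M) r) (B `&` cball (root M) r))))%E.

Record marked_bcm (R : realType) (tau : bcm_structure R) := MarkedBcm {
  marked_space :> rooted_bcm R;
  mark : tau marked_space }.

Definition marked_equiv (R : realType) (tau : bcm_structure R)
    (x y : marked_bcm tau) : Prop :=
  exists f : isometric_embedding x y,
    [/\ bijective f, root_preserving f & tau_map f (mark x) = mark y].

Lemma embedding_eq (R : realType) (X Y : bcm R)
  (f g : isometric_embedding X Y) : f =1 g -> f = g.
Proof.
case: f g => [f fP] [g gP] /= /funext fg.
by move: fP; rewrite fg => fP; congr IsometricEmbedding; exact: Prop_irrelevance.
Qed.

Lemma marked_equiv_refl (R : realType) (tau : bcm_structure R)
  (x : marked_bcm tau) : marked_equiv x x.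
Proof.
exists (embedding_id x); split => //; first by exists id.
by rewrite tau_id.
Qed.

Lemma marked_equiv_sym (R : realType) (tau : bcm_structure R)
  (x y : marked_bcm tau) : marked_equiv x y -> marked_equiv y x.
Proof.
move=> [f [[g fK gK] fr fa]].
have gP (u v : y) : mdist (g u) (g v) = mdist u v.
  by rewrite -(embedding_mdist f) !gK.
pose h := IsometricEmbedding gP; exists h; split.
- by exists f.
- by rewrite /root_preserving /= -[in LHS]fr fK.
- rewrite -fa -[LHS]/((tau_map h \o tau_map f) (mark x)) -tau_comp.
  by rewrite (_ : embedding_comp h f = embedding_id x) ?tau_id//; exact: embedding_eq.
Qed.

Lemma marked_equiv_trans (R : realType) (tau : bcm_structure R)
  (y x z : marked_bcm tau) :
  marked_equiv x y -> marked_equiv y z -> marked_equiv x z.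
Proof.
move=> [f [fb fr fa]] [g [gb gr ga]].
exists (embedding_comp g f); split; first exact: bij_comp.
- by rewrite /root_preserving /= fr.
- by rewrite tau_comp /= fa.
Qed.

Definition marked_dist (R : realType) (tau : bcm_structure R)
    (srm : space_rooted_metrization tau) (x y : marked_bcm tau) : \bar R :=
  ereal_inf [set e : \bar R |
    exists (Z : rooted_bcm R)
      (f : isometric_embedding x Z) (g : isometric_embedding y Z),
      [/\ root_preserving f, root_preserving g &
          e = maxe (fell_dist (M := Z) (range f) (range g))
                   (srm Z (tau_map f (mark x)) (tau_map g (mark y)))%:E]].

Lemma marked_dist_equivl (R : realType) (tau : bcm_structure R)
  (srm : space_rooted_metrization tau) (x x' y : marked_bcm tau) :
  marked_equiv x x' -> (marked_dist srm x y <= marked_dist srm x' y)%E.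
Proof.
move=> [h [[k hK kK] hr ha]].
apply: le_ereal_inf => _ [Z [f [g [fr gr ->]]]].
exists Z, (embedding_comp f h), g; split => //.
  by rewrite /root_preserving /= hr.
congr (maxe (fell_dist _ _) _); last by rewrite tau_comp /= ha.
rewrite eqEsubset; split => [_ [u _ <-]|_ [u _ <-]] /=.
- by exists (k u) => //=; rewrite kK.
- by exists (h u).
Qed.

Lemma marked_dist_sym (R : realType) (tau : bcm_structure R)
  (srm : space_rooted_metrization tau) (x y : marked_bcm tau) :
  marked_dist srm x y = marked_dist srm y x.
Proof.
suff dist_le (u v : marked_bcm tau) :
    (marked_dist srm u v <= marked_dist srm v u)%E.
  by apply/le_anti; rewrite !dist_le.
apply: le_ereal_inf => _ [Z [g [f [gr fr ->]]]].
exists Z, f, g; split => //.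
congr (maxe _ _%:E); last by case: (srm_metric srm Z).
rewrite /fell_dist; apply: eq_integral => r _; congr (_ * mine _ _)%E.
congr ereal_inf; apply/seteqP.
by split => _ [e [e0 A B] <-]; exists e.
Qed.

(* [marked_dist] only depends on the equivalence classes of its arguments. *)
Lemma marked_dist_equiv (R : realType) (tau : bcm_structure R)
  (srm : space_rooted_metrization tau) (x x' y y' : marked_bcm tau) :
  marked_equiv x x' -> marked_equiv y y' ->
  marked_dist srm x y = marked_dist srm x' y'.
Proof.
have dist_eq (u u' v : marked_bcm tau) : marked_equiv u u' ->
    marked_dist srm u v = marked_dist srm u' v.
  move=> uu'; apply/le_anti; rewrite marked_dist_equivl//=.
  by apply: marked_dist_equivl; exact: marked_equiv_sym.
move=> xx' yy'; rewrite (dist_eq x x')// marked_dist_sym (dist_eq y y')//.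
exact: marked_dist_sym.
Qed.

(* The points are the equivalence classes themselves; the library's quotient
   [{eq_quot _}] and even [set (marked_bcm tau)] are ruled out by universe
   constraints, as [marked_bcm tau] lives one universe above [metricType]. *)
Record moduli (R : realType) (tau : bcm_structure R) := Moduli {
  moduli_class : marked_bcm tau -> Prop;
  moduli_classP : exists x, moduli_class = marked_equiv x }.

Definition moduli_repr (R : realType) (tau : bcm_structure R)
    (x : moduli tau) : marked_bcm tau :=
  projT1 (cid (moduli_classP x)).

Definition moduli_dist (R : realType) (tau : bcm_structure R)
    (srm : space_rooted_metrization tau) (x y : moduli tau) : \bar R :=
  marked_dist srm (moduli_repr x) (moduli_repr y).

(* Main.v *)
(** Finiteness and the triangle inequality come from gluing rooted bcm spaces:
    along the roots for the former, along the middle space [Y] for the latter.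
    In a common space the Fell distance satisfies the triangle inequality; since
    it is an integral, this needs measurability in [r] of the truncated
    Hausdorff distance, whose superlevel sets are open to the right.

    If the distance of [X] and [Y] is zero, take couplings of [X] and [Y] of
    cost at most [1/(n+1)] and glue all of them along [X].  The resulting space
    [Z] is boundedly compact because the copies [g_n Y] converge to [X] on
    balls.  An ultrafilter limit of the [g_n] is an isometric embedding [h] with
    image [X], and a subsequence of the [g_n] converges to [h] uniformly on
    compact sets.  Embedding-continuity then identifies the limit of the marks
    [tau_(g_n) a_Y] as [tau_h a_Y], while the costs identify it as the mark of
    [X]. *)

Require Import Defs.
From HB Require Import structures.
From mathcomp Require Import all_boot all_order all_algebra.
From mathcomp Require Import all_classical all_reals all_analysis.
From mathcomp Require Import measurable_realfun lra.

Set Implicit Arguments.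
Unset Strict Implicit.
Unset Printing Implicit Defensive.

Import Order.TTheory GRing.Theory Num.Theory.
Import numFieldNormedType.Exports.

Local Open Scope classical_set_scope.
Local Open Scope ring_scope.

(** * Pseudometrics, metric identification and gluing *)

(** Distinct points may have distance zero, so gluings can be built on plain products and identified
    only afterwards. *)
Record pseudometric (R : realType) (T : Type) := Pseudometric {
  pdist :> T -> T -> R;
  pdistxx : forall x, pdist x x = 0;
  pdistC : forall x y, pdist x y = pdist y x;
  pdist_triangle : forall y x z, pdist x z <= pdist x y + pdist y z }.

Lemma pdist_ge0 (R : realType) (T : Type) (d : pseudometric R T) x y :
  0 <= d x y.
Proof.
by have := pdist_triangle d y x x; rewrite pdistxx (pdistC d y); lra.
Qed.

Definition pullback (R : realType) (T : Type) (M : metricType R) (f : T -> M) :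
    pseudometric R T :=
  @Pseudometric R T (fun x y => mdist (f x) (f y)) (fun x => mdistxx (f x))
    (fun x y => metric_sym (f x) (f y))
    (fun y x z => metric_triangle (f x) (f y) (f z)).

(* The metric identification of a pseudometric space, realised as the image of
   the Kuratowski map [t |-> d t]. *)
Definition metric_quotient (R : realType) (T : Type) (d : pseudometric R T) :=
  {f : T -> R | exists t, f = d t}.

Section MetricQuotient.
Context {R : realType} {T : Type} (d : pseudometric R T).

Definition mq_proj (t : T) : metric_quotient d :=
  exist _ (d t : T -> R) (ex_intro _ t erefl).

Definition mq_repr (z : metric_quotient d) : T := projT1 (cid (proj2_sig z)).

Lemma mq_reprK : cancel mq_repr mq_proj.
Proof.
move=> [f fP]; rewrite /mq_repr; case: cid => t /= ft.
by apply: eq_exist => /=; rewrite ft.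
Qed.

Lemma mq_proj_eq s t : mq_proj s = mq_proj t -> forall u, d s u = d t u.
Proof. by move=> [] /= st u; rewrite st. Qed.

Let dist (z w : metric_quotient d) : R := d (mq_repr z) (mq_repr w).

Let dist_proj s t : dist (mq_proj s) (mq_proj t) = d s t.
Proof.
rewrite /dist (mq_proj_eq (mq_reprK (mq_proj s))) pdistC.
by rewrite (mq_proj_eq (mq_reprK (mq_proj t))) pdistC.
Qed.

HB.instance Definition _ := gen_eqMixin (metric_quotient d).
HB.instance Definition _ := gen_choiceMixin (metric_quotient d).

Let dist_eq0 z w : dist z w = 0 -> z = w.
Proof.
move=> zw; rewrite -(mq_reprK z) -(mq_reprK w).
apply: eq_exist; apply/funext => u /=; move: zw; rewrite /dist => zw.
have := pdist_triangle d (mq_repr w) (mq_repr z) u.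
have := pdist_triangle d (mq_repr z) (mq_repr w) u.
by rewrite (pdistC d (mq_repr w) (mq_repr z)); lra.
Qed.

HB.instance Definition _ := isMetric.Build R (metric_quotient d)
  (fun z => pdistxx d (mq_repr z)) dist_eq0
  (fun z w => pdistC d (mq_repr z) (mq_repr w))
  (fun y x z => pdist_triangle d (mq_repr y) (mq_repr x) (mq_repr z)).

Lemma mdist_mq_proj s t :
  mdist (mq_proj s) (mq_proj t) = d s t :> R.
Proof. exact: dist_proj. Qed.

Lemma mq_proj_surj z : exists t, mq_proj t = z.
Proof. by exists (mq_repr z); rewrite mq_reprK. Qed.

End MetricQuotient.

Section Glue.
Context (R : realType) (I : eqType) (A X : Type) (d : I -> pseudometric R A).
Context (f : I -> X -> A) (x0 : X).
Hypothesis df : forall i j x x', d i (f i x) (f i x') = d j (f j x) (f j x').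

(** Between different copies this is the infimal length of a path crossing over at a common point of
    [X]. All copies share the carrier [A]; only [d i] and [f i] vary with the index. *)
Definition glue_dist (p q : I * A) : R :=
  if p.1 == q.1 then d p.1 p.2 q.2 else
  inf [set d p.1 p.2 (f p.1 x) + d q.1 (f q.1 x) q.2 | x in setT].

Lemma glue_dist_le i j a b x :
  glue_dist (i, a) (j, b) <= d i a (f i x) + d j (f j x) b.
Proof.
rewrite /glue_dist /=; case: eqVneq => [<-|ij]; first exact: pdist_triangle.
apply: ge_inf; last by exists x.
by exists 0 => _ [y _ <-]; rewrite addr_ge0 // pdist_ge0.
Qed.

Lemma glue_dist_ge c i j a b : i != j ->
  (forall x, c <= d i a (f i x) + d j (f j x) b) ->
  c <= glue_dist (i, a) (j, b).
Proof.
move=> ij cP; rewrite /glue_dist /= (negbTE ij).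
by apply: lb_le_inf; [exists (d i a (f i x0) + d j (f j x0) b), x0|move=> _ [x _ <-]].
Qed.

Lemma glue_distE i a b : glue_dist (i, a) (i, b) = d i a b.
Proof. by rewrite /glue_dist eqxx. Qed.

Lemma glue_distxx p : glue_dist p p = 0.
Proof. by rewrite /glue_dist eqxx pdistxx. Qed.

Lemma glue_dist_sym p q : glue_dist p q = glue_dist q p.
Proof.
rewrite /glue_dist eq_sym; case: eqP => [->|_]; first exact: pdistC.
congr inf; apply/seteqP; split=> [_ [x _ <-]|_ [x _ <-]]; exists x => //;
  by rewrite addrC; congr (_ + _); exact: pdistC.
Qed.

(** A path crossing at [x] and again at [x'] runs through copy [j] in between. By [df] the segment
    from [f j x] to [f j x'] is as long as its counterpart in copy [i] or [k], so the path shortens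
    to one with at most one crossing. *)
Lemma glue_dist_triangle q p r :
  glue_dist p r <= glue_dist p q + glue_dist q r.
Proof.
case: p q r => i a [j b] [k c].
have [<-|ij] := eqVneq i j.
  have [<-|ik] := eqVneq i k; first by rewrite !glue_distE; exact: pdist_triangle.
  rewrite glue_distE -lerBlDl; apply: glue_dist_ge => // x; rewrite lerBlDl.
  have := glue_dist_le i k a c x; have := pdist_triangle (d i) b a (f i x).
  by lra.
rewrite -lerBlDr; apply: glue_dist_ge => // x; rewrite lerBlDr.
have [<-|jk] := eqVneq j k.
  rewrite glue_distE; have := glue_dist_le i j a c x.
  by have := pdist_triangle (d j) b (f j x) c; lra.
rewrite -lerBlDl; apply: glue_dist_ge => // x'; rewrite lerBlDl.
have [<-|ik] := eqVneq i k.
  rewrite glue_distE.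
  have := pdist_triangle (d i) (f i x) a c.
  have := pdist_triangle (d i) (f i x') (f i x) c.
  have := pdist_triangle (d j) b (f j x) (f j x').
  by rewrite (df i j x x'); lra.
have := glue_dist_le i k a c x.
have := pdist_triangle (d k) (f k x') (f k x) c.
have := pdist_triangle (d j) b (f j x) (f j x').
by rewrite (df k j x x'); lra.
Qed.

Definition glue : pseudometric R (I * A) :=
  @Pseudometric R _ glue_dist
    glue_distxx glue_dist_sym glue_dist_triangle.

Lemma glue_diag i a b : glue (i, a) (i, b) = d i a b.
Proof. exact: glue_distE. Qed.

(** Crossing at [x] itself is optimal: by [df], crossing at another [x'] replaces one side of a
    triangle in copy [j] by the other two. Hence all copies of [X] coincide in the metric
    quotient. *)
Lemma glue_base i j x b : glue (i, f i x) (j, b) = d j (f j x) b.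
Proof.
have [<-|ij] := eqVneq i j; first exact: glue_diag.
apply/le_anti/andP; split.
  by have := glue_dist_le i j (f i x) b x; rewrite pdistxx add0r.
apply: glue_dist_ge => // x'; rewrite (df i j); exact: pdist_triangle.
Qed.

End Glue.

(** * Bounded compactness and the Hausdorff distance *)

Definition isometric (R : realType) (M N : metricType R) (f : M -> N) : Prop :=
  forall x y, mdist (f x) (f y) = mdist x y.

(** By [approx_mem] such a subset contains all its limit points, so closedness is never assumed
    separately. *)
Definition boundedly_compact (R : realType) (M : metricType R) (B : set M) :
    Prop :=
  forall z r, compact (B `&` cball z r).

Section MetricLemmas.
Context {R : realType} {M : metricType R}.
Implicit Types (x y z : M) (A B C K : set M).

Lemma near_mdist x (e : R) : 0 < e -> \forall y \near x, mdist x y < e.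
Proof.
move=> e0; have := nbhsx_ballx x _ e0.
by rewrite ballEmdist.
Qed.

Lemma nbhs_mdist x A : nbhs x A -> exists2 e : R, 0 < e &
  forall y, mdist x y < e -> A y.
Proof.
move=> /nbhs_ballP[e e0 eA]; exists e => // y xy; apply: eA.
by rewrite ballEmdist.
Qed.

(** Within distance [phi x / 2] of [x] the function stays above [phi x / 2]; compactness turns these
    local bounds into one. *)
Lemma compact_lipschitz_gt0 K (phi : M -> R) : compact K ->
  (forall x y, phi x <= phi y + mdist x y) ->
  (forall x, K x -> 0 < phi x) ->
  exists2 e, 0 < e & forall x, K x -> e < phi x.
Proof.
move=> /compact_near_coveringP cK lip phi0.
have /cK : forall x, K x ->
    \forall x' \near x & e \near (0 : R)^'+, e < phi x'.
  move=> x Kx; have p0 : 0 < phi x / 2 by rewrite divr_gt0 ?phi0.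
  exists ([set y | mdist x y < phi x / 2], [set e | e < phi x / 2]) => /=.
    by split; [exact: near_mdist|exact: nbhs_right_lt].
  by move=> [y e] /= [xy ex]; have := lip x y; lra.
move=> Ke; near (0 : R)^'+ => e.
exists e => //; near: e; exact: Ke.
Unshelve. all: by end_near. Qed.

Lemma closed_cball z (r : R) : closed (cball z r).
Proof.
move=> y cl; rewrite /cball /= leNgt; apply/negP => ry.
have e0 : 0 < mdist z y - r by rewrite subr_gt0.
have [w [zw yw]] := cl _ (near_mdist y e0).
move: zw yw; rewrite /cball /= => zw yw.
by have := metric_triangle z w y; rewrite (metric_sym w y); lra.
Qed.

(** If [z] were outside [B], the distance to [z] would be positive, hence bounded below, on the
    compact part of [B] in the unit ball around [z]. *)
Lemma approx_mem B z : boundedly_compact B ->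
  (forall e : R, 0 < e -> exists2 b, B b & mdist z b < e) -> B z.
Proof.
move=> cB app; apply: contrapT => Bz.
have [|b [Bb zb]|e e0 eP] := compact_lipschitz_gt0 (phi := mdist z) (cB z 1).
- by move=> x y; rewrite (metric_sym x y); exact: metric_triangle.
- by rewrite mdist_gt0; apply/eqP => zb'; apply: Bz; rewrite zb'.
(* The cap at [1] keeps the approximating point in the compact piece [cball z 1]. *)
have m0 : 0 < Num.min e 1 by rewrite lt_min e0 ltr01.
have [b Bb] := app _ m0; rewrite lt_min => /andP[be b1].
by have := eP b (conj Bb (ltW b1)); lra.
Qed.

Lemma compact_mdist_bounded K z : compact K ->
  exists r : R, forall x, K x -> mdist z x <= r.
Proof.
move=> /compact_near_coveringP cK.
have /cK : forall x, K x -> \forall x' \near x & n \near \oo, mdist z x' <= n%:R.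
  move=> x _; exists ([set y | mdist x y < 1],
      [set n | (Num.truncn (mdist z x + 1)).+1 <= n]%N) => /=.
    by split; [exact: near_mdist|exact: nbhs_infty_ge].
  move=> [y n] /= [xy nx].
  have zx := metric_triangle z x y.
  have zx1 : mdist z x + 1 < (Num.truncn (mdist z x + 1)).+1%:R.
    exact: truncnS_gt.
  have : (Num.truncn (mdist z x + 1)).+1%:R <= n%:R :> R by rewrite ler_nat.
  by lra.
move=> H; near \oo => n; exists n%:R; near: n; exact: H.
Unshelve. all: by end_near. Qed.

End MetricLemmas.

Lemma isometric_continuous (R : realType) (M N : metricType R) (f : M -> N) :
  isometric f -> continuous f.
Proof.
move=> fE x A /nbhs_mdist[e e0 eA].
have := near_mdist x e0; apply: filterS => y xy.
by apply: eA; rewrite fE.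
Qed.

(** The part of the range in a ball is the image of a closed subset of a ball around some [x0], of
    radius [mdist (f x0) z + r]. *)
Lemma range_boundedly_compact (R : realType) (X : bcm R) (M : metricType R)
  (f : X -> M) : isometric f -> boundedly_compact (range f).
Proof.
move=> fE z r.
have [x0] := bcm_nonempty X.
have -> : range f `&` cball z r = f @` (f @^-1` cball z r).
  apply/seteqP; split => [_ [[x _ <-] xr]|_ [x xr <-]]; first by exists x.
  by split => //; exists x.
apply: continuous_compact.
  exact/continuous_subspaceT/isometric_continuous.
apply: (subclosed_compact _ (@bcm_compact R X x0 (mdist (f x0) z + r))).
  apply: preimage_closed; last exact: closed_cball.
  by move=> x _; exact: isometric_continuous.
move=> x; rewrite /cball /= => xr.
by rewrite -fE (le_trans (metric_triangle _ z _))// lerD2l.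
Qed.

Lemma boundedly_compactU (R : realType) (M : metricType R) (A B : set M) :
  boundedly_compact A -> boundedly_compact B -> boundedly_compact (A `|` B).
Proof. by move=> cA cB z r; rewrite setIUl; apply: compactU. Qed.

Section Hausdorff.
Context {R : realType} {M : metricType R}.
Implicit Types (A B C : set M).

Definition hausdorff_close A B (e : R) : Prop :=
  A `<=` thickening B e /\ B `<=` thickening A e.

Lemma hausdorff_dist_ge0 A B : (0 <= hausdorff_dist A B)%E.
Proof. by apply: le_ereal_inf_tmp => _ [e [e0 _ _] <-]; rewrite lee_fin. Qed.

Lemma hausdorff_dist_le A B e : 0 <= e -> hausdorff_close A B e ->
  (hausdorff_dist A B <= e%:E)%E.
Proof. by move=> e0 [AB BA]; apply: ereal_inf_lbound; exists e. Qed.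

Lemma thickening_le A e e' : e <= e' -> thickening A e `<=` thickening A e'.
Proof. by move=> ee x [y Ay xy]; exists y => //; exact: le_trans ee. Qed.

Lemma hausdorff_dist_lt A B e : (hausdorff_dist A B < e%:E)%E ->
  hausdorff_close A B e.
Proof.
move=> /ereal_inf_lt[_ [e' [e0 AB BA] <-]]; rewrite lte_fin => /ltW ee.
by split; [apply: subset_trans AB _|apply: subset_trans BA _];
  exact: thickening_le.
Qed.

Lemma thickening_trans A B C e e' : A `<=` thickening B e ->
  B `<=` thickening C e' -> A `<=` thickening C (e + e').
Proof.
move=> AB BC a /AB[b /BC[c Cc bc] ab]; exists c => //.
by rewrite (le_trans (metric_triangle _ b _))// lerD.
Qed.

Lemma hausdorff_dist_triangle B A C :
  (hausdorff_dist A C <= hausdorff_dist A B + hausdorff_dist B C)%E.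
Proof.
have := hausdorff_dist_ge0 A B; have := hausdorff_dist_ge0 B C.
case EAB : (hausdorff_dist A B) => [a| |] //; last first.
  by move=> c0 _; rewrite addye ?leey// -ltNye (lt_le_trans _ c0)// ltNy0.
case EBC : (hausdorff_dist B C) => [b| |] // b0 a0; last by rewrite leey.
rewrite -EFinD; apply/lee_addgt0Pr => e e0; rewrite -EFinD.
have /hausdorff_dist_lt[AB BA] : (hausdorff_dist A B < (a + e / 2)%:E)%E.
  by rewrite EAB lte_fin ltrDl divr_gt0.
have /hausdorff_dist_lt[BC CB] : (hausdorff_dist B C < (b + e / 2)%:E)%E.
  by rewrite EBC lte_fin ltrDl divr_gt0.
have -> : a + b + e = (a + e / 2) + (b + e / 2) by lra.
rewrite !lee_fin in a0 b0; apply: hausdorff_dist_le; first by lra.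
split; first exact: thickening_trans AB BC.
by rewrite addrC; exact: thickening_trans CB BA.
Qed.

Lemma hausdorff_distxx A : hausdorff_dist A A = 0%E.
Proof.
apply/le_anti; rewrite hausdorff_dist_ge0 andbT.
by apply: hausdorff_dist_le => //; split => x Ax; exists x; rewrite ?mdistxx.
Qed.

End Hausdorff.

Lemma hausdorff_dist_image (R : realType) (M N : metricType R) (f : M -> N)
  (A B : set M) : isometric f ->
  hausdorff_dist (f @` A) (f @` B) = hausdorff_dist A B.
Proof.
move=> fE; congr ereal_inf; congr image.
have thE (C D : set M) e :
    (f @` C `<=` thickening (f @` D) e) <-> (C `<=` thickening D e).
  split=> [CD c Cc|CD _ [c Cc <-]].
    by have [|_ [d Dd <-] cd] := CD (f c); [exists c|exists d; rewrite // -fE].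
  by have [d Dd cd] := CD c Cc; exists (f d); [exists d|rewrite fE].
by apply/seteqP; split=> e [e0 AB BA]; split=> //; exact/thE.
Qed.

(** For each rational [q], the [r < q] with [[r, q)] inside [S] form an interval, and [S] is the
    countable union of these intervals. *)
Lemma right_open_measurable (R : realType) (S : set R) :
  (forall r, S r -> exists2 e, 0 < e & forall s, r <= s < r + e -> S s) ->
  measurable S.
Proof.
move=> So.
have -> : S = \bigcup_(q : rat)
    [set r | r < ratr q /\ forall s, r <= s < ratr q -> S s].
  apply/seteqP; split => [r Sr|r [q _ [rq]]]; last first.
    by move=> /(_ r); rewrite lexx rq; exact.
  have [e e0 eS] := So r Sr.
  have [|q] := @rat_in_itvoo R r (r + e); first by rewrite ltrDl.
  rewrite in_itv /= => /andP[rq qe]; exists q => //; split => // s /andP[rs sq].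
  by apply: eS; rewrite rs (lt_trans sq).
apply: bigcupT_measurable_rat => q; apply: is_interval_measurable.
move=> x y [xq xS] [yq yS] z /andP[xz zy]; split; first exact: le_lt_trans yq.
by move=> s /andP[zs sq]; apply: xS; rewrite (le_trans xz zs) sq.
Qed.

(** * The Fell distance *)

Lemma mine1_leD (R : realType) (x y z : \bar R) :
  (0 <= y -> 0 <= z -> x <= y + z -> mine 1 x <= mine 1 y + mine 1 z)%E.
Proof.
move=> y0 z0 xyz.
have m1 : (mine 1 x <= 1)%E by rewrite ge_min lexx.
case: (leP 1%E y) => y1.
  by rewrite (le_trans m1)// leeDl// le_min lee01.
case: (leP 1%E z) => z1.
  by rewrite (le_trans m1)// leeDr.
by rewrite (le_trans _ xyz)// ge_min lexx orbT.
Qed.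

Section Fell.
Context {R : realType} (M : rooted_bcm R).
Implicit Types (A B C : set M) (r e : R).

Let rt : M := Defs.root M.

Definition truncated_hausdorff A B r : \bar R :=
  mine 1%E (hausdorff_dist (A `&` cball rt r) (B `&` cball rt r)).

Lemma fell_distE A B : fell_dist A B =
  (\int[lebesgue_measure]_(r in `[0%R, +oo[)
    ((expR (- r))%:E * truncated_hausdorff A B r))%E.
Proof. by []. Qed.

Lemma truncated_hausdorff_ge0 A B r : (0 <= truncated_hausdorff A B r)%E.
Proof. by rewrite le_min lee01 hausdorff_dist_ge0. Qed.

Lemma truncated_hausdorff_le1 A B r : (truncated_hausdorff A B r <= 1)%E.
Proof. by rewrite ge_min lexx. Qed.

Lemma truncated_hausdorff_triangle B A C r :
  (truncated_hausdorff A C r <=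
   truncated_hausdorff A B r + truncated_hausdorff B C r)%E.
Proof.
apply: mine1_leD; [exact: hausdorff_dist_ge0..|].
exact: hausdorff_dist_triangle.
Qed.

(* If some [a] in [A] of norm at most [r] has no [B]-point of norm at most [r]
   within [e], then by compactness all [B]-points within [e] of [a] have norm
   bounded away from [r]. *)
Lemma thickening_fail_right A B r e : boundedly_compact B ->
  ~ (A `&` cball rt r `<=` thickening (B `&` cball rt r) e) ->
  exists2 eta, 0 < eta & forall s, r <= s < r + eta ->
    ~ (A `&` cball rt s `<=` thickening (B `&` cball rt s) e).
Proof.
move=> cB /existsNP[a] /not_implyP[[Aa ar] afar].
have [||eta eta0 far] :=
    compact_lipschitz_gt0 (phi := fun b => mdist rt b - r) (cB a e).
- move=> x y; rewrite addrAC lerB// (metric_sym x y); exact: metric_triangle.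
- move=> b [Bb ab]; rewrite subr_gt0 ltNge; apply/negP => br.
  by apply: afar; exists b.
exists eta => // s /andP[rs sr] /(_ a).
case; first by split => //; apply: le_trans rs.
move=> b [Bb bs] ab; have := far b (conj Bb ab).
by move: bs; rewrite /cball /=; lra.
Qed.

(** Superlevel sets are open to the right, since by [thickening_fail_right] a failure of closeness
    at radius [r] persists for slightly larger radii. *)
Lemma truncated_hausdorff_measurable A B :
  boundedly_compact A -> boundedly_compact B ->
  measurable_fun setT (truncated_hausdorff A B).
Proof.
move=> cA cB; apply: measurable_mine; first exact: measurable_cst.
move=> mD; apply: (measurability _ (ErealGenOInfty.measurableE R)) => //.
move=> _ [_ [c ->] <-]; rewrite setTI; apply: right_open_measurable => r /=.
rewrite in_itv /= andbT => cr.
have [c0|c0] := ltP c 0.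
  exists 1 => // s _; rewrite in_itv /= andbT.
  by rewrite (lt_le_trans _ (hausdorff_dist_ge0 _ _))// lte_fin.
(* A value strictly between [c] and the distance: closeness fails at [e], and its failure at [s]
   gives a distance of at least [e > c] there. *)
have [e ce er] : exists2 e, c < e & (e%:E < hausdorff_dist
    (A `&` cball rt r) (B `&` cball rt r))%E.
  case: (hausdorff_dist _ _) cr => [x| |] //; last first.
    by exists (c + 1); rewrite ?ltry// ltrDl.
  by rewrite lte_fin => cx; exists ((c + x) / 2); rewrite ?lte_fin; lra.
suff [eta eta0 etaP] : exists2 eta, 0 < eta & forall s, r <= s < r + eta ->
    ~ hausdorff_close (A `&` cball rt s) (B `&` cball rt s) e.
  exists eta => // s rs; rewrite in_itv /= andbT (@lt_le_trans _ _ e%:E)//.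
  rewrite leNgt; apply/negP => /hausdorff_dist_lt; exact: etaP.
have : ~ hausdorff_close (A `&` cball rt r) (B `&` cball rt r) e.
  move=> /hausdorff_dist_le; rewrite (le_trans c0 (ltW ce)) => /(_ isT).
  by rewrite leNgt er.
move=> /not_andP[/(thickening_fail_right cB)|/(thickening_fail_right cA)];
  by move=> [eta eta0 etaP]; exists eta => // s /etaP sP [].
Qed.

Let mexpN : measurable_fun setT (fun r => (expR (- r))%:E).
Proof.
apply/measurable_EFinP; apply: measurableT_comp => //.
Qed.

Let fell_measurable A B (D : set R) :
  boundedly_compact A -> boundedly_compact B ->
  measurable_fun D (fun r => (expR (- r))%:E * truncated_hausdorff A B r)%E.
Proof.
move=> cA cB; apply: measurable_funTS; apply: emeasurable_funM => //.
exact: truncated_hausdorff_measurable.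
Qed.

Let fell_integrand_ge0 A B r :
  (0 <= (expR (- r))%:E * truncated_hausdorff A B r)%E.
Proof. by rewrite mule_ge0 ?lee_fin ?expR_ge0 ?truncated_hausdorff_ge0. Qed.

Lemma fell_dist_ge0 A B : (0 <= fell_dist A B)%E.
Proof. by rewrite fell_distE; apply: integral_ge0. Qed.

(** The integrand is the density of the exponential law of rate [1]. *)
Lemma integral_expRN :
  (\int[lebesgue_measure]_(r in `[0%R, +oo[) (expR (- r))%:E)%E = 1%E :> \bar R.
Proof.
rewrite integral_mkcond -[RHS](@integral_exponential_pdf R 1)//.
apply: eq_integral => x _; rewrite /exponential_pdf !patchE.
by case: ifP => // _; rewrite mul1r mulN1r.
Qed.

Lemma fell_dist_le1 A B : boundedly_compact A -> boundedly_compact B ->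
  (fell_dist A B <= 1)%E.
Proof.
move=> cA cB; rewrite fell_distE -integral_expRN.
apply: ge0_le_integral => //.
- exact: fell_measurable.
- exact: measurable_funTS.
- move=> r _; rewrite -[leRHS]mule1 lee_wpmul2l ?lee_fin ?expR_ge0//.
  exact: truncated_hausdorff_le1.
Qed.

Lemma fell_dist_triangle B A C : boundedly_compact A -> boundedly_compact B ->
  boundedly_compact C ->
  (fell_dist A C <= fell_dist A B + fell_dist B C)%E.
Proof.
move=> cA cB cC; rewrite !fell_distE -ge0_integralD//; try exact: fell_measurable.
apply: ge0_le_integral => //.
- exact: fell_measurable.
- by apply: emeasurable_funD; exact: fell_measurable.
- move=> r _; rewrite -ge0_muleDr ?truncated_hausdorff_ge0//.
  by rewrite lee_wpmul2l ?lee_fin ?expR_ge0// truncated_hausdorff_triangle.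
Qed.

Lemma fell_distxx A : fell_dist A A = 0%E.
Proof.
rewrite fell_distE integral0_eq// => r _.
by rewrite /truncated_hausdorff hausdorff_distxx minEle leNgt lte01 mule0.
Qed.

(** If closeness within [e] failed at every radius in [[r, r + 1]], the integrand would be at least
    [expR (- (r + 1)) * e] on an interval of length one; [e <= 1] keeps the truncation harmless. *)
Lemma fell_dist_lt A B r e : boundedly_compact A -> boundedly_compact B ->
  0 <= r -> 0 < e <= 1 -> (fell_dist A B < (expR (- (r + 1)) * e)%:E)%E ->
  A `&` cball rt r `<=` thickening B e /\ B `&` cball rt r `<=` thickening A e.
Proof.
move=> cA cB r0 /andP[e0 e1] ABe.
have [s [rs] sclose] : exists s, r <= s /\
    hausdorff_close (A `&` cball rt s) (B `&` cball rt s) e.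
  apply: contrapT => far; move: ABe; apply/negP; rewrite -leNgt.
  have -> : (expR (- (r + 1)) * e)%:E = (\int[lebesgue_measure]_(s in `[r, (r + 1)%R])
      (cst (expR (- (r + 1)) * e)%:E s))%E.
    rewrite integral_cst//= lebesgue_measure_itv /= lte_fin ltrDl ltr01.
    by rewrite -EFinB addrAC subrr add0r mule1.
  rewrite fell_distE.
  apply: (@le_trans _ _ (\int[lebesgue_measure]_(s in `[r, (r + 1)%R])
    ((expR (- s))%:E * truncated_hausdorff A B s))%E).
    apply: ge0_le_integral => //.
    - by move=> s _; rewrite lee_fin mulr_ge0 ?expR_ge0// ltW.
    - exact: fell_measurable.
    - move=> s /=; rewrite in_itv /= => /andP[rs sr].
      rewrite EFinM lee_pmul ?lee_fin ?expR_ge0 ?(ltW e0)//.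
        by rewrite ler_expR lerN2.
      rewrite le_min lee_fin e1 /= leNgt; apply/negP => /hausdorff_dist_lt sc.
      by apply: far; exists s.
  apply: ge0_subset_integral => //; first exact: fell_measurable.
  move=> s /=; rewrite !in_itv /= => /andP[rs _].
  by rewrite (le_trans r0 rs).
case: sclose => AB BA.
(* The good radius [s] may exceed [r], so a partner may lie outside the ball of radius [r]; the
   conclusion therefore thickens all of [A] and [B]. *)
have sub (C : set M) : C `&` cball rt r `<=` C `&` cball rt s.
  by move=> x [Cx xr]; split => //; exact: le_trans rs.
by split => x /sub; [move=> /AB|move=> /BA]; move=> [y [Cy _] xy]; exists y.
Qed.

End Fell.

(** Embeddings that fix roots carry traces of balls to traces of balls, so the Fell distance does
    not depend on the ambient space. *)
Lemma fell_dist_image (R : realType) (M N : rooted_bcm R)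
  (f : isometric_embedding M N) (A B : set M) : root_preserving f ->
  fell_dist (f @` A) (f @` B) = fell_dist A B.
Proof.
move=> fr; rewrite /fell_dist; apply: eq_integral => r _.
congr (_ * mine _ _)%E.
have imE (C : set M) :
    f @` C `&` cball (Defs.root N) r = f @` (C `&` cball (Defs.root M) r).
  rewrite -fr; apply/seteqP; split => [_ [[x Cx <-] xr]|_ [x [Cx xr] <-]].
    by exists x => //; split => //; rewrite /cball /= -(embedding_mdist f).
  by split; [exists x|rewrite /cball /= embedding_mdist].
by rewrite !imE; apply: hausdorff_dist_image => x y; exact: embedding_mdist.
Qed.

(** * Amalgams and couplings *)

Lemma image_range (A B C : Type) (k : B -> C) (f : A -> B) (g : A -> C) :
  (forall a, k (f a) = g a) -> k @` range f = range g.
Proof.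
move=> kf; apply/seteqP; split => [_ [_ [a _ <-] <-]|_ [a _ <-]].
  by exists a.
by exists (f a) => //; exists a.
Qed.

Section Lift.
Context {R : realType} {T : Type} (d : pseudometric R T) {M : metricType R}.
Context (h : T -> M) (hE : forall s t, mdist (h s) (h t) = d s t).

Definition mq_lift (z : metric_quotient d) : M := h (mq_repr z).

Lemma mq_lift_isometric : isometric mq_lift.
Proof.
move=> z w; rewrite hE -[in RHS](mq_reprK z) -[in RHS](mq_reprK w).
by rewrite mdist_mq_proj.
Qed.

Lemma mq_lift_proj t : mq_lift (mq_proj d t) = h t.
Proof.
by apply: (@mdist_positivity R); rewrite hE -(mdist_mq_proj d) mq_reprK mdistxx.
Qed.

End Lift.

Lemma compact_cball_cover (R : realType) (X Y : bcm R) (M : metricType R)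
    (f : X -> M) (g : Y -> M) : isometric f -> isometric g ->
  (forall z, range f z \/ range g z) ->
  forall (z : M) (r : R), compact (cball z r).
Proof.
move=> fE gE cov z r; rewrite -[cball z r]setTI.
have -> : [set: M] = range f `|` range g.
  by apply/seteqP; split => w // _; exact: cov.
by apply: boundedly_compactU; exact: range_boundedly_compact.
Qed.

(** [X] is a bare type: [unit] glues at a single point, a bcm space glues along a whole copy of
    it. *)
Lemma amalgam (R : realType) (Z1 Z2 : bcm R) (X : Type) (x0 : X)
    (f1 : X -> Z1) (f2 : X -> Z2) :
  (forall x x', mdist (f1 x) (f1 x') = mdist (f2 x) (f2 x')) ->
  exists (Z : bcm R) (j1 : isometric_embedding Z1 Z)
    (j2 : isometric_embedding Z2 Z), forall x, j1 (f1 x) = j2 (f2 x).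
Proof.
move=> fE.
(* The product serves as common carrier; each of the two pseudometrics ignores one coordinate. *)
pose d (b : bool) : pseudometric R (Z1 * Z2) :=
  if b then pullback fst else pullback snd.
pose f (b : bool) x := (f1 x, f2 x).
have df i j x x' : d i (f i x) (f i x') = d j (f j x) (f j x').
  by case: i; case: j => /=.
pose D := glue x0 df.
pose j1 z := mq_proj D (true, (z, f2 x0)).
pose j2 z := mq_proj D (false, (f1 x0, z)).
have j1E : isometric j1 by move=> x y; rewrite mdist_mq_proj glue_diag.
have j2E : isometric j2 by move=> x y; rewrite mdist_mq_proj glue_diag.
have cov (z : metric_quotient D) : range j1 z \/ range j2 z.
  have [[[] [z1 z2]] <-] := mq_proj_surj z; [left; exists z1|right; exists z2] => //;
  by apply: (@mdist_positivity R); rewrite mdist_mq_proj glue_diag /= mdistxx.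
exists (Bcm (inhabits (j1 (f1 x0))) (compact_cball_cover j1E j2E cov)).
exists (@IsometricEmbedding R Z1 (Bcm _ _) j1 j1E).
exists (@IsometricEmbedding R Z2 (Bcm _ _) j2 j2E) => x /=.
apply: (@mdist_positivity R); rewrite mdist_mq_proj.
apply/le_anti; rewrite pdist_ge0 andbT.
by have := glue_dist_le d f true false (f1 x, f2 x0) (f1 x0, f2 x) x;
  rewrite /= !mdistxx addr0.
Qed.

(** Encodes a common ambient space as a pseudometric on the fixed carrier [X + Y], so that a whole
    sequence of couplings can be fed to [glue]. *)
Record coupling (R : realType) (X Y : rooted_bcm R) := Coupling {
  coupling_dist :> pseudometric R (X + Y);
  coupling_inl : forall x x', coupling_dist (inl x) (inl x') = mdist x x';
  coupling_inr : forall y y', coupling_dist (inr y) (inr y') = mdist y y';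
  coupling_root : coupling_dist (inl (Defs.root X)) (inr (Defs.root Y)) = 0 }.

Section Coupling.
Context {R : realType} {X Y : rooted_bcm R} (c : coupling X Y).

Let inl_isometric : isometric (fun x => mq_proj c (inl x)).
Proof. by move=> x y; rewrite mdist_mq_proj coupling_inl. Qed.

Let inr_isometric : isometric (fun y => mq_proj c (inr y)).
Proof. by move=> x y; rewrite mdist_mq_proj coupling_inr. Qed.

Let cover (z : metric_quotient c) :
  range (fun x => mq_proj c (inl x)) z \/ range (fun y => mq_proj c (inr y)) z.
Proof.
by have [[x|y] <-] := mq_proj_surj z; [left; exists x|right; exists y].
Qed.

Definition coupling_space : rooted_bcm R :=
  @RootedBcm R (Bcm (inhabits (mq_proj c (inl (Defs.root X))))
    (compact_cball_cover inl_isometric inr_isometric cover))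
    (mq_proj c (inl (Defs.root X))).

Definition coupling_embl : isometric_embedding X coupling_space :=
  @IsometricEmbedding R X coupling_space _ inl_isometric.

Definition coupling_embr : isometric_embedding Y coupling_space :=
  @IsometricEmbedding R Y coupling_space _ inr_isometric.

Lemma coupling_embr_root : root_preserving coupling_embr.
Proof.
apply: (@mdist_positivity R).
by rewrite mdist_mq_proj pdistC coupling_root.
Qed.

Context (Z : rooted_bcm R) (h : X + Y -> Z).
Context (hE : forall s t, mdist (h s) (h t) = c s t).

Definition coupling_lift : isometric_embedding coupling_space Z :=
  @IsometricEmbedding R coupling_space Z _ (mq_lift_isometric hE).

Lemma coupling_lift_embl x : coupling_lift (coupling_embl x) = h (inl x).
Proof. exact: (mq_lift_proj hE). Qed.

Lemma coupling_lift_embr y : coupling_lift (coupling_embr y) = h (inr y).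
Proof. exact: (mq_lift_proj hE). Qed.

Lemma coupling_lift_root : h (inl (Defs.root X)) = Defs.root Z ->
  root_preserving coupling_lift.
Proof. by move=> hr; rewrite /root_preserving -hr -coupling_lift_embl. Qed.

Context (tau : bcm_structure R) (srm : space_rooted_metrization tau).
Context (f : isometric_embedding X Z) (g : isometric_embedding Y Z).
Hypotheses (fr : root_preserving f)
  (fh : forall x, f x = h (inl x)) (gh : forall y, g y = h (inr y)).

(** [coupling_lift] preserves roots, hence [srm]; by functoriality the distance of the marks depends
    on the coupling alone and not on [Z]. *)
Lemma coupling_lift_srm a b :
  srm Z (tau_map f a) (tau_map g b) =
  srm coupling_space (tau_map coupling_embl a) (tau_map coupling_embr b).
Proof.
have kr : root_preserving coupling_lift by apply: coupling_lift_root; rewrite -fh.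
rewrite -(srm_isometric srm kr) -[tau_map _ (tau_map coupling_embl a)]/
  ((tau_map _ \o tau_map _) a) -[tau_map _ (tau_map coupling_embr b)]/
  ((tau_map _ \o tau_map _) b) -!tau_comp.
congr (srm Z (tau_map _ a) (tau_map _ b)); apply: embedding_eq => u.
  by rewrite fh -coupling_lift_embl.
by rewrite gh -coupling_lift_embr.
Qed.

Lemma coupling_lift_fell :
  fell_dist (M := Z) (range f) (range g) =
  fell_dist (M := coupling_space) (range coupling_embl) (range coupling_embr).
Proof.
have kr : root_preserving coupling_lift by apply: coupling_lift_root; rewrite -fh.
rewrite -[RHS](fell_dist_image _ _ kr).
rewrite (image_range (g := f)) ?(image_range (g := g))// => u.
  by rewrite coupling_lift_embr -gh.
by rewrite coupling_lift_embl -fh.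
Qed.

End Coupling.

(** * The marked distance is a finite pseudometric *)

Section MarkedDist.
Context {R : realType} {tau : bcm_structure R}.
Context (srm : space_rooted_metrization tau).
Implicit Types x y z : marked_bcm tau.

Lemma embedding_range_boundedly_compact (X Y : bcm R)
  (f : isometric_embedding X Y) : boundedly_compact (range f).
Proof. by apply: range_boundedly_compact => u v; exact: embedding_mdist. Qed.

Lemma marked_dist_ge0 x y : (0 <= marked_dist srm x y)%E.
Proof.
apply: le_ereal_inf_tmp => _ [Z [f [g [fr gr ->]]]].
by rewrite le_max fell_dist_ge0.
Qed.

Lemma marked_dist_lty x y : (marked_dist srm x y < +oo)%E.
Proof.
have [Z [j1 [j2 jE]]] := @amalgam R x y unit tt (fun=> Defs.root x)
  (fun=> Defs.root y) (fun _ _ => etrans (mdistxx _) (esym (mdistxx _))).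
pose W := @RootedBcm R Z (j1 (Defs.root x)).
apply: le_lt_trans (_ : maxe (fell_dist (M := W) (range j1) (range j2))
  (srm W (tau_map j1 (mark x)) (tau_map j2 (mark y)))%:E < +oo)%E.
  apply: ereal_inf_lbound; exists W, j1, j2; split => //.
  by rewrite /root_preserving -(jE tt).
rewrite gt_max ltry andbT (@le_lt_trans _ _ 1%E)//; last exact: ltry.
by apply: fell_dist_le1; exact: embedding_range_boundedly_compact.
Qed.

Lemma marked_dist_fin_num x y : marked_dist srm x y \is a fin_num.
Proof. by rewrite ge0_fin_numE ?marked_dist_ge0 ?marked_dist_lty. Qed.

Lemma marked_distxx x : marked_dist srm x x = 0%E.
Proof.
apply/le_anti; rewrite marked_dist_ge0 andbT.
apply: ereal_inf_lbound; exists x, (embedding_id x), (embedding_id x).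
split => //; rewrite fell_distxx tau_id.
by have [_ d0 _ _] := srm_metric srm x; rewrite (d0 _ _).2 ?maxxx.
Qed.

Lemma marked_dist_triangle y x z :
  (marked_dist srm x z <= marked_dist srm x y + marked_dist srm y z)%E.
Proof.
apply/lee_addgt0Pr => e e0; have e20 : 0 < e / 2 by rewrite divr_gt0.
have [_ [Z1 [f1 [g1 [f1r g1r ->]]]]] :=
  lb_ereal_inf_adherent e20 (marked_dist_fin_num x y).
rewrite gt_max => /andP[fell1 srm1].
have [_ [Z2 [f2 [g2 [f2r g2r ->]]]]] :=
  lb_ereal_inf_adherent e20 (marked_dist_fin_num y z).
rewrite gt_max => /andP[fell2 srm2].
have [Z [j1 [j2 jE]]] := @amalgam R Z1 Z2 y (Defs.root y) g1 f2 (fun u v =>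
  etrans (embedding_mdist g1 u v) (esym (embedding_mdist f2 u v))).
pose W := @RootedBcm R Z (j1 (Defs.root Z1)).
have j1r : root_preserving (Y := W) j1 by [].
have j2r : root_preserving (Y := W) j2.
  by rewrite /root_preserving /= -f2r -g1r jE.
have -> : (marked_dist srm x y + marked_dist srm y z + e%:E =
  (marked_dist srm x y + (e / 2)%:E) + (marked_dist srm y z + (e / 2)%:E))%E.
  by rewrite addeACA -EFinD -splitr.
apply: le_trans (_ : maxe (fell_dist (M := W)
    (range (embedding_comp j1 f1)) (range (embedding_comp j2 g2)))
  (srm W (tau_map (embedding_comp j1 f1) (mark x))
    (tau_map (embedding_comp j2 g2) (mark z)))%:E <= _)%E.
  apply: ereal_inf_lbound; exists W, (embedding_comp j1 f1), (embedding_comp j2 g2).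
  by split => //; rewrite /root_preserving /= ?f1r ?g2r.
(* Both routes embed [y] identically, so its image and its mark serve as middle terms for the Fell
   distance and for [srm]. *)
have jgE : embedding_comp j1 g1 = embedding_comp j2 f2 by apply: embedding_eq.
rewrite ge_max; apply/andP; split.
  have rc (V : bcm R) (k : isometric_embedding V W) : boundedly_compact (range k).
    exact: embedding_range_boundedly_compact.
  apply: le_trans (fell_dist_triangle (rc _ (embedding_comp j1 f1))
    (rc _ (embedding_comp j1 g1)) (rc _ (embedding_comp j2 g2))) _.
  have rcomp (V V' : bcm R) (k : isometric_embedding V' W)
      (f : isometric_embedding V V') : range (embedding_comp k f) = k @` range f.
    by rewrite (image_range (g := embedding_comp k f)).
  rewrite {2}jgE !rcomp; apply: leeD.
    by rewrite (fell_dist_image (N := W) _ _ j1r) ltW.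
  by rewrite (fell_dist_image (N := W) _ _ j2r) ltW.
have [_ _ _ /(_ _ (tau_map (embedding_comp j1 g1) (mark y)))tri] := srm_metric srm W.
apply: le_trans (_ : _ <= (_ + _)%:E)%E _; first by rewrite lee_fin; exact: tri.
rewrite {2}jgE !tau_comp /= (srm_isometric srm j1r) (srm_isometric srm j2r).
by rewrite EFinD; apply: leeD; exact: ltW.
Qed.

(** The metric of a nearly optimal ambient space is pulled back to [x + y], which leaves both costs
    unchanged. *)
Lemma marked_dist_coupling x y e : (marked_dist srm x y < e%:E)%E ->
  exists c : coupling x y,
    (fell_dist (M := coupling_space c)
      (range (coupling_embl c)) (range (coupling_embr c)) < e%:E)%E /\
    srm (coupling_space c) (tau_map (coupling_embl c) (mark x))
      (tau_map (coupling_embr c) (mark y)) < e.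
Proof.
move=> /ereal_inf_lt[_ [Z [f [g [fr gr ->]]]]]; rewrite gt_max => /andP[fell_e srm_e].
pose h (s : x + y) : Z := match s with inl u => f u | inr v => g v end.
have cl u v : pullback h (inl u) (inl v) = mdist u v := embedding_mdist f u v.
have cr u v : pullback h (inr u) (inr v) = mdist u v := embedding_mdist g u v.
have c0 : pullback h (inl (Defs.root x)) (inr (Defs.root y)) = 0.
  by rewrite /= fr gr mdistxx.
exists (Coupling cl cr c0); split.
  by rewrite -(@coupling_lift_fell _ _ _ _ _ h _ f g).
by rewrite -(@coupling_lift_srm _ _ _ _ _ h _ _ _ f g) -?lte_fin.
Qed.

End MarkedDist.

(** * Limits of couplings *)

(** Compactness gives a cluster point. It is a limit: were the preimage of a neighbourhood not in
    [U], its complement would be, contradicting clustering. *)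
Lemma ultrafilter_cvg (T : Type) (M : topologicalType) (U : set_system T)
    (K : set M) (f : T -> M) : UltraFilter U -> compact K ->
  (forall t, K (f t)) -> exists2 z, K z & f @ U --> z.
Proof.
move=> UU cK Kf; have PU : ProperFilter U by exact: ultra_proper.
have UK : U (f @^-1` K) by apply: filterE => t; exact: Kf.
have [z [Kz clz]] := cK (f @ U) _ UK.
exists z => // B zB; have [//|nB] := in_ultra_setVsetC (f @^-1` B) UU.
by have [w [nBw /nBw]] := clz (~` B) B nB zB.
Qed.

Section Limit.
Context {R : realType} {X Y : rooted_bcm R} (c : nat -> coupling X Y).
Hypothesis c_close : forall r e : R, 0 < e -> \forall n \near \oo,
  (forall x, mdist (Defs.root X) x <= r -> exists y, c n (inl x) (inr y) <= e) /\
  (forall y, mdist (Defs.root Y) y <= r -> exists x, c n (inl x) (inr y) <= e).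

Let df i j (x x' : X) : c i (inl x) (inl x') = c j (inl x) (inl x').
Proof. by rewrite !coupling_inl. Qed.

Let D := glue (Defs.root X) df.
Let Q : metricType R := metric_quotient D.
(** The index [0] is arbitrary, since all copies of [X] are identified by [proj_inl]. *)
Let base x : Q := mq_proj D (0%N, inl x).
Let leaf n y : Q := mq_proj D (n, inr y).
Let rho := base (Defs.root X).

Let proj_inl n x : mq_proj D (n, inl x) = base x.
Proof.
apply: (@mdist_positivity R); rewrite mdist_mq_proj.
by rewrite (glue_base (Defs.root X) df) pdistxx.
Qed.

Let base_leaf x n y : mdist (base x) (leaf n y) = c n (inl x) (inr y).
Proof. by rewrite mdist_mq_proj (glue_base (Defs.root X) df). Qed.

Let base_isometric : isometric base.
Proof. by move=> x y; rewrite mdist_mq_proj glue_diag coupling_inl. Qed.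

Let leaf_isometric n : isometric (leaf n).
Proof. by move=> x y; rewrite mdist_mq_proj glue_diag coupling_inr. Qed.

Let leaf_root n : leaf n (Defs.root Y) = rho.
Proof.
apply/esym; apply: (@mdist_positivity R).
by rewrite base_leaf coupling_root.
Qed.

Let root_leaf n y : mdist rho (leaf n y) = mdist (Defs.root Y) y.
Proof. by rewrite -(leaf_root n) leaf_isometric. Qed.

Let root_base x : mdist rho (base x) = mdist (Defs.root X) x.
Proof. exact: base_isometric. Qed.

(* A filter on a ball that does not cluster on the compact ball of [base X] of
   radius one more leaves a neighbourhood of it, which contains the ball of
   almost all copies of [Y]; finitely many compact pieces remain. *)
Let compact_cball_root r : compact (cball (rho : Q) r).
Proof.
move=> F PF FK; apply: contrapT => noz.
have ncl (z : Q) : ~ cluster F z.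
  move=> clz; apply: noz; exists z; split => //; apply: closed_cball => B zB.
  exact: clz FK zB.
have := @range_boundedly_compact R X _ base base_isometric rho (r + 1).
move=> /compact_near_coveringP cC.
(* The pair [p] consists of a point and a radius. Compactness yields one [A] in [F] and one [e > 0]
   such that [A] stays at distance at least [e] from the whole compact piece. *)
have /cC : forall z, (range base `&` cball rho (r + 1)) z ->
    \forall z' \near z & p \near filter_prod F (0 : R)^'+,
      ~ mdist z' p.1 < p.2.
  move=> z _; have /existsNP[A /existsNP[B]] := ncl z.
  move=> /not_implyP[FA] /not_implyP[/nbhs_mdist[e e0 eB] AB].
  exists ([set z' | mdist z z' < e / 2], A `*` [set e' | e' < e / 2]) => /=.
    split; first by apply: (@near_mdist R Q z); rewrite divr_gt0.
    exists (A, [set e' | e' < e / 2]) => //=; split => //.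
    by apply: nbhs_right_lt; rewrite divr_gt0.
  move=> [z' [w e']] /= [zz' [Aw e'e]] z'w; apply: AB; exists w; split => //.
  by apply: eB; have := metric_triangle z z' w; lra.
move=> -[[A E] /= [FA E0] AE].
have [e [e0 Ee]] : exists e : R, 0 < e /\ E e.
  suff /filter_ex : (0 : R)^'+ ([set e | 0 < e] `&` E) by [].
  by apply: filterI => //; exact: nbhs_right_gt.
(* A point [w] of a late copy is this close to some [base x]: the bound [1] puts [base x] in the
   ball of radius [r + 1], and [e / 2] then contradicts [far]. *)
have m0 : 0 < Num.min e 1 / 2 by rewrite divr_gt0// lt_min e0 ltr01.
have [N _ NP] := c_close r m0.
pose L (n : nat) : set Q := range (leaf n) `&` cball rho r.
pose K' := \bigcup_(n < N) L n.
have cK' : compact K'.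
  by rewrite /K' bigcup_mkord; apply: bigsetU_compact => n _;
    exact: range_boundedly_compact.
have FK' : F K'.
  apply: filterS (filterI FA FK) => w [Aw wr].
  have far z : range base z -> mdist rho z <= r + 1 -> e <= mdist z w.
    move=> bz zr; have := AE (w, e) (conj Aw Ee) z (conj bz zr).
    by rewrite /= leNgt => /negP.
  have [[n [x|y]]] := mq_proj_surj w; rewrite ?proj_inl => wE.
    have wr1 : mdist rho w <= r + 1 by rewrite (le_trans wr)// lerDl.
    by have := far w (ex_intro2 _ _ x I wE) wr1; rewrite mdistxx leNgt e0.
  have [Nn|nN] := leqP N n; last first.
    by exists n => //; split => //; exists y.
  have {}wE : leaf n y = w := wE.
  exfalso; have [_ /(_ y)] := NP n Nn.
  have -> : mdist (Defs.root Y) y = mdist rho w by rewrite -wE root_leaf.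
  move=> /(_ wr)[x]; rewrite -base_leaf wE => xw.
  have me : Num.min e 1 <= e by rewrite ge_min lexx.
  have m1 : Num.min e 1 <= 1 by rewrite ge_min lexx orbT.
  have := far (base x); have := metric_triangle rho w (base x).
  rewrite (metric_sym w); move: wr; rewrite /cball /= => wr tri.
  by move=> /(_ (ex_intro2 _ _ x I erefl)); lra.
by have [z [_ /ncl]] := cK' F PF FK'.
Qed.

Let compact_cball (z : Q) r : compact (cball z r).
Proof.
apply: subclosed_compact (@compact_cball_root (mdist rho z + r)) _.
  exact: closed_cball.
move=> w zw; rewrite /cball /=; apply: le_trans (metric_triangle _ z _) _.
by rewrite lerD2l.
Qed.

Let Z : rooted_bcm R :=
  @RootedBcm R (Bcm (inhabits rho) compact_cball) rho.

(** Each sequence [leaf n y] stays in a fixed compact ball, so an ultrafilter finer than [\oo]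
    yields all pointwise limits at once; they are isometric, and uniform convergence on balls allows
    a return to sequences. *)
Lemma coupling_limit : exists (Z : rooted_bcm R) (j : nat -> X + Y -> Z)
    (b : isometric_embedding X Z) (g : nat -> isometric_embedding Y Z)
    (h : isometric_embedding Y Z) (k : nat -> nat),
  [/\ forall n s t, mdist (j n s) (j n t) = c n s t,
      root_preserving b /\ (forall n x, b x = j n (inl x)),
      forall n y, g n y = j n (inr y),
      range b = range h /\ root_preserving h &
      (forall n, n <= k n)%N /\
      {family compact, (fun n => g (k n) : Y -> Z) @ \oo --> (h : Y -> Z)}].
Proof.
have [U [UU ooU]] := ultraFilterLemma (eventually_filter).
have PU : ProperFilter U by exact: ultra_proper.
have limP (y : Y) : exists z : Z, (fun n => leaf n y : Z) @ U --> z.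
  have [|z _ zU] := @ultrafilter_cvg nat Z U (cball rho (mdist (Defs.root Y) y))
    (fun n => leaf n y) UU (@compact_cball rho _); last by exists z.
  by move=> n; rewrite /cball /= root_leaf.
have [h hP] := choice limP.
have hU y e : 0 < e -> \forall n \near U, mdist (h y) (leaf n y : Z) < e.
  by move=> e0; exact: (hP y _ (@near_mdist R Z (h y) e e0)).
have h_isometric : isometric h.
  move=> y y'; apply/eqP; rewrite eq_le; apply/andP; split;
      apply/ler_addgt0Pl => e e0; have e20 : 0 < e / 2 by rewrite divr_gt0.
    have [n [yn y'n]] := filter_ex (filterI (hU y _ e20) (hU y' _ e20)).
    rewrite (@le_trans _ _ (mdist (h y) (leaf n y) +
      (mdist (leaf n y) (leaf n y') + mdist (leaf n y') (h y'))))//.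
      by rewrite (le_trans (metric_triangle _ (leaf n y) _))// lerD2l metric_triangle.
    by rewrite leaf_isometric (metric_sym _ (h y')); move: yn y'n => /=; lra.
  have [n [yn y'n]] := filter_ex (filterI (hU y _ e20) (hU y' _ e20)).
  rewrite -(leaf_isometric n) (@le_trans _ _ (mdist (leaf n y) (h y) +
    (mdist (h y) (h y') + mdist (h y') (leaf n y'))))//.
    by rewrite (le_trans (metric_triangle _ (h y) _))// lerD2l metric_triangle.
  by rewrite (metric_sym (leaf n y)); move: yn y'n => /=; lra.
(* All maps involved are isometric, so closeness within [e / 3] at [y] spreads to a neighbourhood,
   and compactness of the ball gives uniformity. *)
have unif r e : 0 < e -> \forall n \near U, forall y,
    mdist (Defs.root Y) y <= r -> mdist (h y) (leaf n y) < e.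
  move=> e0; have e30 : 0 < e / 3 by rewrite divr_gt0.
  have := @bcm_compact R Y (Defs.root Y) r.
  move=> /compact_near_coveringP cK; apply: cK => y _.
  exists ([set y' | mdist y y' < e / 3],
      [set n | mdist (h y) (leaf n y) < e / 3]) => /=.
    by split; [exact: near_mdist|exact: hU].
  move=> [y' n] /= [yy' yn].
  have := metric_triangle (h y') (h y) (leaf n y').
  have := metric_triangle (h y) (leaf n y) (leaf n y').
  by rewrite leaf_isometric h_isometric (metric_sym y'); lra.
(* Radius [n] and error [1/(n+1)] at the index [k n] turn convergence along [U] into uniform
   convergence of a sequence on compact sets. *)
have kP n : exists k, (n <= k)%N /\ forall y,
    mdist (Defs.root Y) y <= n%:R -> mdist (h y) (leaf k y) < n.+1%:R^-1.
  have n0 : 0 < n.+1%:R^-1 :> R by rewrite invr_gt0.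
  have [k [kn ku]] := filter_ex (filterI (ooU _ (nbhs_infty_ge n)) (unif n%:R _ n0)).
  by exists k.
have [k {}kP] := choice kP.
pose b' := @IsometricEmbedding R X Z base base_isometric.
pose g' n := @IsometricEmbedding R Y Z (leaf n) (leaf_isometric n).
pose h' := @IsometricEmbedding R Y Z h h_isometric.
exists Z, (fun n s => mq_proj D (n, s)), b', g', h', k; split => //.
- by move=> n s t; rewrite mdist_mq_proj glue_diag.
- by split => // n x; rewrite proj_inl.
- split.
    apply/seteqP; split => [_ [x _ <-]|_ [y _ <-]].
      apply: approx_mem; first exact: range_boundedly_compact.
      (* The cap at [1] bounds the norm of the partner [y] by that of [x] plus one, the radius at
         which [unif] is applied. *)
      move=> e e0; have e20 : 0 < Num.min e 1 / 2 by rewrite divr_gt0// lt_min e0 ltr01.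
      have [n [un cn]] := filter_ex (filterI (unif (mdist (Defs.root X) x + 1) _ e20)
        (ooU _ (c_close (mdist (Defs.root X) x) e20))).
      have [/(_ x (lexx _))[y xy] _] := cn.
      have me : Num.min e 1 <= e by rewrite ge_min lexx.
      have m1 : Num.min e 1 <= 1 by rewrite ge_min lexx orbT.
      exists (h y); first by exists y.
      rewrite -base_leaf in xy.
      have yr : mdist (Defs.root Y) y <= mdist (Defs.root X) x + 1.
        rewrite -(root_leaf n); have := metric_triangle rho (base x) (leaf n y).
        by rewrite root_base; lra.
      have := metric_triangle (base x) (leaf n y) (h y).
      by rewrite (metric_sym (leaf n y)); have /= := un y yr; lra.
    (* Here [y] is fixed in advance, so pointwise convergence suffices. *)
    apply: approx_mem; first exact: range_boundedly_compact.
    move=> e e0; have e20 : 0 < e / 2 by rewrite divr_gt0.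
    have [n [un cn]] := filter_ex (filterI (hU y _ e20)
      (ooU _ (c_close (mdist (Defs.root Y) y) e20))).
    have [_ /(_ y (lexx _))[x xy]] := cn.
    exists (base x); first by exists x.
    rewrite -base_leaf metric_sym in xy.
    by have := metric_triangle (h y) (leaf n y) (base x); move: un xy => /=; lra.
  apply: (@mdist_positivity R); apply/le_anti; rewrite mdist_ge0 andbT.
  apply/ler_addgt0Pl => e e0; rewrite addr0.
  have [n] := filter_ex (hU (Defs.root Y) e e0).
  by rewrite leaf_root => /ltW.
split; first by move=> n; have [] := kP n.
apply/fam_cvgP => A cA P /uniform_nbhs[E [entE EP]].
move: entE; rewrite -entourage_ballE => -[e /= e0 eE].
have [r rA] := compact_mdist_bounded (Defs.root Y) cA.
near=> n; apply: EP => y Ay; apply: eE; rewrite /= ballEmdist /=.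
have [_ /(_ y)] := kP n; move=> /(_ _)/lt_trans; apply.
  apply: le_trans (rA y Ay) _; near: n; exact: nbhs_infty_ger.
near: n; exact: near_infty_natSinv_lt (PosNum e0).
Unshelve. all: by end_near. Qed.

End Limit.

(** * Separation *)

Lemma embedding_inj (R : realType) (X Y : bcm R) (f : isometric_embedding X Y) :
  injective f.
Proof.
move=> x y fxy; apply: (@mdist_positivity R).
by rewrite -(embedding_mdist f) fxy mdistxx.
Qed.

Lemma coupling_close (R : realType) (X Y : rooted_bcm R)
    (c : nat -> coupling X Y) :
  (forall n, (fell_dist (M := coupling_space (c n))
    (range (coupling_embl (c n))) (range (coupling_embr (c n))) <
      n.+1%:R^-1%:E)%E) ->
  forall r e : R, 0 < e -> \forall n \near \oo,
  (forall x, mdist (Defs.root X) x <= r -> exists y, c n (inl x) (inr y) <= e) /\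
  (forall y, mdist (Defs.root Y) y <= r -> exists x, c n (inl x) (inr y) <= e).
Proof.
move=> fell_c r e e0.
(* These adjusted values meet the conditions [0 <= r'] and [0 < e' <= 1] of [fell_dist_lt]. *)
pose r' := Num.max r 0; pose e' := Num.min e 1.
have r'0 : 0 <= r' by rewrite le_max lexx orbT.
have rr' : r <= r' by rewrite le_max lexx.
have e'01 : 0 < e' <= 1 by rewrite lt_min e0 ltr01 ge_min lexx orbT.
have e'e : e' <= e by rewrite ge_min lexx.
have m0 : 0 < expR (- (r' + 1)) * e'.
  by rewrite mulr_gt0 ?expR_gt0//; case/andP: e'01.
have := near_infty_natSinv_lt (PosNum m0); apply: filterS => n /= nm.
have fell_n : (fell_dist (M := coupling_space (c n))
    (range (coupling_embl (c n))) (range (coupling_embr (c n))) <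
    (expR (- (r' + 1)) * e')%:E)%E.
  by apply: lt_trans (fell_c n) _; rewrite lte_fin.
have [XY YX] := fell_dist_lt (@embedding_range_boundedly_compact _ _ _ _)
  (@embedding_range_boundedly_compact _ _ _ _) r'0 e'01 fell_n.
split => [x xr|y yr].
  have [|_ [y _ <-]] := XY (coupling_embl (c n) x).
    split; first by exists x.
    rewrite -(embedding_mdist (coupling_embl (c n))) in xr.
    exact: le_trans xr rr'.
  by rewrite mdist_mq_proj => xy; exists y; exact: le_trans e'e.
have [|_ [x _ <-]] := YX (coupling_embr (c n) y).
  split; first by exists y.
  rewrite -(embedding_mdist (coupling_embr (c n))) coupling_embr_root in yr.
  exact: le_trans yr rr'.
by rewrite mdist_mq_proj pdistC => xy; exists x; exact: le_trans e'e.
Qed.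

Lemma marked_dist_eq0 (R : realType) (tau : bcm_structure R)
    (srm : space_rooted_metrization tau) (x y : marked_bcm tau) :
  embedding_continuous tau -> marked_dist srm x y = 0%E -> marked_equiv x y.
Proof.
move=> tau_cont xy0.
have cP n : exists c : coupling x y,
    (fell_dist (M := coupling_space c)
      (range (coupling_embl c)) (range (coupling_embr c)) < n.+1%:R^-1%:E)%E /\
    srm (coupling_space c) (tau_map (coupling_embl c) (mark x))
      (tau_map (coupling_embr c) (mark y)) < n.+1%:R^-1.
  by apply: marked_dist_coupling; rewrite xy0 lte_fin invr_gt0.
have [c {}cP] := choice cP.
have [Z [j [b [g [h [k [jE [br bj] gj [bh hr] [kge gh]]]]]]]] :=
  coupling_limit (coupling_close (fun n => (cP n).1)).
have [srm_ge0 srm_eq0 srmC srm_tri] := srm_metric srm Z.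
have srm_bg n : srm Z (tau_map b (mark x)) (tau_map (g n) (mark y)) < n.+1%:R^-1.
  rewrite (@coupling_lift_srm _ _ _ _ _ (j n) (jE n) _ _ b (g n) br)//.
  exact: (cP n).2.
(* The middle term is the mark carried by [g (k n)]: it is near the left side by the cost bound, as
   [n <= k n], and near the right side by embedding-continuity. *)
have hb : tau_map b (mark x) = tau_map h (mark y).
  apply/srm_eq0/le_anti; rewrite srm_ge0 andbT; apply/ler_addgt0Pl => e e0.
  rewrite addr0; have e20 : 0 < e / 2 by rewrite divr_gt0.
  have nb : nbhs (tau_map h (mark y))
      [set t | srm Z (tau_map h (mark y)) t < e / 2].
    by apply: (srm_topology srm _ _).2; exists (e / 2).
  have near_h : \forall n \near \oo,
      srm Z (tau_map h (mark y)) (tau_map (g (k n)) (mark y)) < e / 2.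
    exact: tau_cont gh (mark y) _ nb.
  have near_e : \forall n \near \oo, n.+1%:R^-1 < e / 2.
    exact: (near_infty_natSinv_lt (PosNum e20)).
  have [n [hn ne]] := filter_ex (filterI near_h near_e).
  apply: le_trans (srm_tri _ (tau_map (g (k n)) (mark y)) _) _.
  have kn : (k n).+1%:R^-1 <= n.+1%:R^-1 :> R.
    by rewrite lef_pV2 ?posrE// ler_nat ltnS.
  rewrite (srmC _ (tau_map h _)); rewrite [leRHS]splitr.
  by rewrite lerD// ltW// (lt_trans (lt_le_trans (srm_bg _) kn)).
(* As [b] and [h] have the same range, [phi], the composite of [h] with the inverse of [b], is an
   isometry from [y] onto [x]. *)
have phiP v : exists u, b u = h v.
  have : range h (h v) by exists v.
  by rewrite -bh => -[u _ uv]; exists u.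
have psiP u : exists v, h v = b u.
  have : range b (b u) by exists u.
  by rewrite bh => -[v _ uv]; exists v.
have [[phi bphi] [psi hpsi]] := (choice phiP, choice psiP).
have phiE u v : mdist (phi u) (phi v) = mdist u v.
  by rewrite -(embedding_mdist b) !bphi embedding_mdist.
apply: marked_equiv_sym; exists (IsometricEmbedding phiE); split.
- exists psi => [v|u]; first by apply: (@embedding_inj _ _ _ h); rewrite hpsi bphi.
  by apply: (@embedding_inj _ _ _ b); rewrite bphi hpsi.
- by apply: (@embedding_inj _ _ _ b); rewrite /= bphi hr br.
(* Since [b] after [phi] is [h], both marks have the same image under [tau_map b], which is
   injective. *)
- have [inj_b _ _] := tau_embedding tau b; apply: inj_b; rewrite hb.
  rewrite -[LHS]/((tau_map b \o tau_map _) (mark y)) -tau_comp.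
  by congr (tau_map _ (mark y)); apply: embedding_eq => v /=.
Qed.

(** * Passage to equivalence classes *)

Lemma moduli_eq (R : realType) (tau : bcm_structure R) (x y : moduli tau) :
  marked_equiv (moduli_repr x) (moduli_repr y) -> x = y.
Proof.
rewrite /moduli_repr; case: x y => [c cP] [c' cP'] /=.
case: cid => a /= ca; case: cid => b /= cb ab.
suff cc : c = c' by move: cP'; rewrite -cc => cQ; rewrite (Prop_irrelevance cP cQ).
rewrite ca cb; apply/funext => z; apply/propext; split => [az|bz].
  by apply: marked_equiv_trans az; exact: marked_equiv_sym.
exact: marked_equiv_trans bz.
Qed.

Theorem theorem6p19 (R : realType) (tau : bcm_structure R)
    (srm : space_rooted_metrization tau) :
  embedding_continuous tau ->
  (forall x y : moduli tau, moduli_dist srm x y \is a fin_num) /\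
  is_metric (fun x y : moduli tau => fine (moduli_dist srm x y)).
Proof.
move=> tau_cont.
have fin (x y : moduli tau) : moduli_dist srm x y \is a fin_num.
  exact: marked_dist_fin_num.
split => //; split.
- by move=> x y; apply: fine_ge0; exact: marked_dist_ge0.
- move=> x y; split => [xy|->]; last by rewrite /moduli_dist marked_distxx.
  apply: moduli_eq; apply: (marked_dist_eq0 (srm := srm) tau_cont).
  by rewrite -[LHS](fineK (fin x y)) xy.
- by move=> x y; rewrite /moduli_dist marked_dist_sym.
- move=> x y z; rewrite -lee_fin EFinD !fineK//.
  exact: marked_dist_triangle.
Qed.
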